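(* Let $H$ be a skew left brace acting on a trivial brace (abelian group) $I$ via a good triplet of actions $(\nu,\mu,\sigma)$. Let the opposite skew left brace $H^{\mathrm{op}}$ act on $I$ via $(\nu^{\mathrm{op}},\mu^{\mathrm{op}},\sigma^{\mathrm{op}})$, where $\mu^{\mathrm{op}}_h=\mu_{-h}$, $\nu^{\mathrm{op}}_h=\mu_{-h}\nu_h$ and $\sigma^{\mathrm{op}}_h=\sigma_h$ for $h\in H$. Then $\mathrm{H}^2_{Sb}(H,I)\cong\mathrm{H}^2_{Sb}(H^{\mathrm{op}},I)$ as groups.
   Context: A skew left brace is a set $H$ with two group structures $(H,+)$ (not necessarily abelian) and $(H,\circ)$ such that $a\circ(b+c)=(a\circ b)-a+(a\circ c)$ for all $a,b,c$; the two identities coincide and are denoted $0$. Put $\lambda_a(b)=-a+(a\circ b)$. The opposite skew left brace is $H^{\mathrm{op}}=(H,+^{\mathrm{op}},\circ)$ with $a+^{\mathrm{op}}b=b+a$. An abelian group is viewed as a trivial brace ($+$ and $\circ$ coincide). $H$ acts on an abelian group $I$ via a good triplet of actions $(\nu,\mu,\sigma)$ if $\nu:(H,\circ)\to\mathrm{Aut}(I)$ is a homomorphism, $\mu:(H,+)\to\mathrm{Aut}(I)$ and $\sigma:(H,\circ)\to\mathrm{Aut}(I)$ are anti-homomorphisms, and for all $h_1,h_2,h_3\in H$, $y\in I$: $\mu_{\lambda_{h_1}(h_3)}(y)=\nu_{h_1}(\mu_{h_3}(\nu_{h_1}^{-1}(y)))$ and $\nu_{h_2+h_3}(\sigma_{h_2+h_3}(y))+\mu_{h_3}(y)=\mu_{h_3}(\nu_{h_2}(\sigma_{h_2}(y)))+\nu_{h_3}(\sigma_{h_3}(y))$.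 For a group $G$ acting from the right on an abelian group $A$ (an anti-homomorphism $g\mapsto\rho_g\in\mathrm{Aut}(A)$), a normalized $2$-cocycle is a map $c:G\times G\to A$, vanishing when an argument is the identity, with $c(g_2,g_3)-c(g_1g_2,g_3)+c(g_1,g_2g_3)-\rho_{g_3}(c(g_1,g_2))=0$. For a skew left brace $H$ acting on $I$ via $(\nu,\mu,\sigma)$, $\mathrm{Z}^2_{Sb}(H,I)$ is the group of pairs $(\beta,\tau)$ of maps $H\times H\to I$ (vanishing when an argument is $0$) such that $\beta$ is a $2$-cocycle of $(H,+)$ with right action $\mu$, $\overline\tau(h_1,h_2):=\nu^{-1}_{h_1\circ h_2}(\tau(h_1,h_2))$ is a $2$-cocycle of $(H,\circ)$ with right action $\sigma$, and for all $h_1,h_2,h_3\in H$ $$\mu_{\lambda_{h_1}(h_3)}(\tau(h_1,h_2))-\tau(h_1,h_2+h_3)+\tau(h_1,h_3)=\nu_{h_1}(\beta(h_2,h_3))+\mu_{h_1\circ h_3}(\beta(h_1,-h_1))-\beta(-h_1,h_1\circ h_3)-\beta(h_1\circ h_2,\lambda_{h_1}(h_3)).$$ Two pairs $(\beta_1,\tau_1),(\beta_2,\tau_2)$ are cohomologous if there is $\theta:H\to I$ with $\theta(0)=0$ such that $(\beta_1-\beta_2)(h_1,h_2)=\theta(h_2)-\theta(h_1+h_2)+\mu_{h_2}(\theta(h_1))$ and $(\tau_1-\tau_2)(h_1,h_2)=\nu_{h_1}(\theta(h_2))-\theta(h_1\circ h_2)+\nu_{h_1\circ h_2}(\sigma_{h_2}(\nu_{h_1}^{-1}(\theta(h_1))))$.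 $\mathrm{H}^2_{Sb}(H,I)$ is the group of cohomology classes. $\mathrm{H}^2_{Sb}(H^{\mathrm{op}},I)$ is defined in the same way from the skew left brace $H^{\mathrm{op}}$ (with its own addition, negation and lambda map) and the actions $(\nu^{\mathrm{op}},\mu^{\mathrm{op}},\sigma^{\mathrm{op}})$. *)

(* Defs.v *)
From HB Require Import structures.
From mathcomp Require Import all_boot all_algebra.
From mathcomp Require Import boolp functions.

Set Implicit Arguments.
Unset Strict Implicit.
Unset Printing Implicit Defensive.

Import GRing.Theory.
Local Open Scope ring_scope.

(* A group law on T, as a record rather than as the library's [groupType],
   because a skew left brace carries two of them on the same type. *)
Record group_on (T : Type) := GroupOn {
  gop : T -> T -> T;
  gone : T;
  ginv : T -> T;
  gopA : associative gop;
  gop1x : left_id gone gop;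
  gopx1 : right_id gone gop;
  gopVx : left_inverse gone ginv gop;
  gopxV : right_inverse gone ginv gop
}.

Section GroupOnTheory.
Variables (T : Type) (G : group_on T).
Local Notation "x * y" := (gop G x y).
Local Notation "x ^-1" := (ginv G x).

Lemma gopKx x y : x^-1 * (x * y) = y.
Proof. by rewrite gopA gopVx gop1x. Qed.

Lemma gopVKx x y : x * (x^-1 * y) = y.
Proof. by rewrite gopA gopxV gop1x. Qed.

Lemma gopxK x y : x * y * y^-1 = x.
Proof. by rewrite -gopA gopxV gopx1. Qed.

Lemma gopxVK x y : x * y^-1 * y = x.
Proof. by rewrite -gopA gopVx gopx1. Qed.

Lemma gopI x : injective (gop G x).
Proof. by move=> y z /(congr1 (gop G x^-1)); rewrite !gopKx. Qed.

Lemma ginv_uniq x y : x * y = gone G -> x^-1 = y.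
Proof. by move=> xy; apply: (@gopI x); rewrite gopxV xy. Qed.

Lemma ginvK : involutive (ginv G).
Proof. by move=> x; apply: ginv_uniq; rewrite gopVx. Qed.

Lemma ginvM x y : (x * y)^-1 = y^-1 * x^-1.
Proof. by apply: ginv_uniq; rewrite gopA gopxK gopxV. Qed.

Lemma ginv1 : (gone G)^-1 = gone G.
Proof. by apply: ginv_uniq; rewrite gop1x. Qed.

Definition gopp : group_on T :=
  @GroupOn T (fun x y => y * x) (gone G) (ginv G)
    (fun x y z => esym (gopA G z y x))
    (gopx1 G) (gop1x G) (gopxV G) (gopVx G).

End GroupOnTheory.

Record skewBrace := SkewBrace {
  sb_car :> Type;
  sb_add : group_on sb_car;
  sb_circ : group_on sb_car;
  sb_distr : forall a b c,
    gop sb_circ a (gop sb_add b c) =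
    gop sb_add (gop sb_add (gop sb_circ a b) (ginv sb_add a)) (gop sb_circ a c)
}.

Declare Scope brace_scope.
Delimit Scope brace_scope with SB.
Notation "0" := (gone (sb_add _)) : brace_scope.
Notation "a + b" := (gop (sb_add _) a b) : brace_scope.
Notation "- a" := (ginv (sb_add _) a) : brace_scope.
Notation "a - b" := (gop (sb_add _) a (ginv (sb_add _) b)) : brace_scope.
Notation "a <o> b" := (gop (sb_circ _) a b)
  (at level 40, left associativity) : brace_scope.

Definition lam (H : skewBrace) (a b : H) : H := (- a + (a <o> b))%SB.

Section BraceTheory.
Variable H : skewBrace.
Implicit Types a b c : H.

Lemma sb_circx0 a : (a <o> 0 = a)%SB.
Proof.
have e : (- a + (a <o> 0) = 0)%SB.
  apply: (@gopI _ (sb_add H) (a <o> 0)%SB).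
  by rewrite gopA -sb_distr gopx1 gopx1.
by rewrite -[LHS](gopVKx (sb_add H) a) e gopx1.
Qed.

Lemma sb_unitE : gone (sb_circ H) = gone (sb_add H).
Proof. by rewrite -[RHS](gop1x (sb_circ H)) sb_circx0. Qed.

Lemma lamN a b : (lam a (- b) = - (a <o> b) + a)%SB.
Proof.
have : (a = (a <o> b) - a + (a <o> (- b)))%SB.
  by rewrite -sb_distr gopxV sb_circx0.
by move=> {3}->; rewrite /lam -!gopA gopKx.
Qed.

Lemma sb_op_distr a b c :
  (a <o> (c + b) = (a <o> c) + (- a + (a <o> b)))%SB.
Proof. by rewrite sb_distr -gopA. Qed.

Definition sb_op : skewBrace :=
  @SkewBrace H (gopp (sb_add H)) (sb_circ H) sb_op_distr.

End BraceTheory.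

(* The inverse is determined by the underlying map; it is kept as data so that
   [nu^-1] can be written directly. *)
Record zaut (I : zmodType) := ZAut {
  zaut_val :> {additive I -> I};
  zaut_inv : I -> I;
  zautK : cancel zaut_val zaut_inv;
  zautVK : cancel zaut_inv zaut_val
}.

Section ZAutTheory.
Variable I : zmodType.

Definition zaut_comp (f g : zaut I) : zaut I :=
  @ZAut I (f \o g : {additive I -> I}) (zaut_inv g \o zaut_inv f)
    (can_comp (zautK f) (zautK g)) (can_comp (zautVK g) (zautVK f)).

Lemma zaut_inj (f : zaut I) : injective f.
Proof. exact: can_inj (zautK f). Qed.

Lemma zaut_invB (f : zaut I) : {morph zaut_inv f : x y / x - y}.
Proof.
by move=> x y; apply: (@zaut_inj f); rewrite raddfB !zautVK.
Qed.

Lemma zaut_inv0 (f : zaut I) : zaut_inv f 0 = 0.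
Proof. by rewrite -[X in zaut_inv f X](raddf0 f) zautK. Qed.

End ZAutTheory.

Definition aut_hom (T : Type) (G : group_on T) (I : zmodType)
    (rho : T -> zaut I) : Prop :=
  forall g h y, rho (gop G g h) y = rho g (rho h y).

Definition aut_antihom (T : Type) (G : group_on T) (I : zmodType)
    (rho : T -> zaut I) : Prop :=
  forall g h y, rho (gop G g h) y = rho h (rho g y).

Record good_triplet (H : skewBrace) (I : zmodType) := GoodTriplet {
  nu : H -> zaut I;
  mu : H -> zaut I;
  sigma : H -> zaut I;
  nu_hom : aut_hom (sb_circ H) nu;
  mu_antihom : aut_antihom (sb_add H) mu;
  sigma_antihom : aut_antihom (sb_circ H) sigma;
  mu_lam : forall (h1 h3 : H) (y : I),
    mu (lam h1 h3) y = nu h1 (mu h3 (zaut_inv (nu h1) y));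
  nu_sigma_add : forall (h2 h3 : H) (y : I),
    nu (h2 + h3)%SB (sigma (h2 + h3)%SB y) + mu h3 y =
    mu h3 (nu h2 (sigma h2 y)) + nu h3 (sigma h3 y)
}.

Section OppositeTriplet.
Variables (H : skewBrace) (I : zmodType) (t : good_triplet H I).
Implicit Types (h a b : H) (y : I).

Definition nu_op (h : sb_op H) : zaut I :=
  zaut_comp (mu t (- h : H)%SB) (nu t h).
Definition mu_op (h : sb_op H) : zaut I := mu t (- h : H)%SB.
Definition sigma_op (h : sb_op H) : zaut I := sigma t h.

Lemma mu0 y : mu t 0%SB y = y.
Proof. by apply: (@zaut_inj _ (mu t 0%SB)); rewrite -(mu_antihom t) gop1x. Qed.

Lemma muNK h y : mu t h (mu t (- h)%SB y) = y.
Proof. by rewrite -mu_antihom gopVx mu0. Qed.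

Lemma muKN h y : mu t (- h)%SB (mu t h y) = y.
Proof. by rewrite -mu_antihom gopxV mu0. Qed.

Lemma zaut_inv_muN h y : zaut_inv (mu t (- h)%SB) y = mu t h y.
Proof. by apply: (@zaut_inj _ (mu t (- h)%SB)); rewrite zautVK muKN. Qed.

Lemma nu_mu a b y : nu t a (mu t b y) = mu t (lam a b) (nu t a y).
Proof. by rewrite mu_lam zautK. Qed.

Lemma nu_op_hom : aut_hom (sb_circ (sb_op H)) nu_op.
Proof.
move=> a b y; rewrite /= nu_hom nu_mu -mu_antihom lamN.
by rewrite gopxK.
Qed.

Lemma mu_op_antihom : aut_antihom (sb_add (sb_op H)) mu_op.
Proof. by move=> a b y; rewrite /mu_op /= ginvM mu_antihom. Qed.

Lemma sigma_op_antihom : aut_antihom (sb_circ (sb_op H)) sigma_op.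
Proof. exact: (sigma_antihom t). Qed.

Lemma mu_op_lam (h1 h3 : sb_op H) y :
  mu_op (lam h1 h3) y = nu_op h1 (mu_op h3 (zaut_inv (nu_op h1) y)).
Proof.
rewrite /mu_op /= zaut_inv_muN nu_mu zautVK -!mu_antihom lamN.
by rewrite /lam /= ginvM ginvK gopxK.
Qed.

Lemma nu_sigma_op_add (h2 h3 : sb_op H) y :
  nu_op (h2 + h3)%SB (sigma_op (h2 + h3)%SB y) + mu_op h3 y =
  mu_op h3 (nu_op h2 (sigma_op h2 y)) + nu_op h3 (sigma_op h3 y).
Proof.
apply: (@zaut_inj _ (mu t (h3 : H))); apply: (@zaut_inj _ (mu t (h2 : H))).
rewrite /mu_op /sigma_op /= !raddfD /= !muNK ginvM -mu_antihom.
by rewrite -ginvM -mu_antihom gopVx mu0 nu_sigma_add addrC.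
Qed.

Definition op_triplet : good_triplet (sb_op H) I :=
  GoodTriplet nu_op_hom mu_op_antihom sigma_op_antihom
    mu_op_lam nu_sigma_op_add.

End OppositeTriplet.

Definition cocycle2 (T : Type) (G : group_on T) (A : zmodType)
    (rho : T -> zaut A) (c : T -> T -> A) : Prop :=
  [/\ forall g, c (gone G) g = 0,
      forall g, c g (gone G) = 0 &
      forall g1 g2 g3,
        c g2 g3 - c (gop G g1 g2) g3 + c g1 (gop G g2 g3) - rho g3 (c g1 g2)
        = 0].

Definition sb_normalized (H : skewBrace) (I : zmodType) (f : H -> H -> I) :=
  forall h, f 0%SB h = 0 /\ f h 0%SB = 0.

Definition sb_cochain (H : skewBrace) (I : zmodType) : zmodType :=
  ((H -> H -> I) * (H -> H -> I))%type.

Section Cohomology.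
Variables (H : skewBrace) (I : zmodType) (t : good_triplet H I).
Let nu := nu t.
Let mu := mu t.
Let sigma := sigma t.

Definition tau_bar (tau : H -> H -> I) (h1 h2 : H) : I :=
  zaut_inv (nu (h1 <o> h2)%SB) (tau h1 h2).

Definition sb_compatible (beta tau : H -> H -> I) : Prop :=
  forall h1 h2 h3 : H,
    mu (lam h1 h3) (tau h1 h2) - tau h1 (h2 + h3)%SB + tau h1 h3 =
    nu h1 (beta h2 h3) + mu (h1 <o> h3)%SB (beta h1 (- h1)%SB)
      - beta (- h1)%SB (h1 <o> h3)%SB - beta (h1 <o> h2)%SB (lam h1 h3).

Definition sb_cocycle (x : sb_cochain H I) : Prop :=
  [/\ sb_normalized x.1,
      sb_normalized x.2,
      cocycle2 (sb_add H) mu x.1,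
      cocycle2 (sb_circ H) sigma (tau_bar x.2) &
      sb_compatible x.1 x.2].

Definition sb_coboundary (x : sb_cochain H I) : Prop :=
  exists theta : H -> I,
    [/\ theta 0%SB = 0,
        forall h1 h2,
          x.1 h1 h2 = theta h2 - theta (h1 + h2)%SB + mu h2 (theta h1) &
        forall h1 h2,
          x.2 h1 h2 = nu h1 (theta h2) - theta (h1 <o> h2)%SB
            + nu (h1 <o> h2)%SB (sigma h2 (zaut_inv (nu h1) (theta h1)))].

Definition sb_cocycle_pred : {pred sb_cochain H I} :=
  fun x => `[< sb_cocycle x >].

Lemma subBB (a b c d : I) : a - b - (c - d) = a - c - (b - d).
Proof. by rewrite !opprD !opprK addrACA. Qed.

Lemma addBB (a b c d : I) : a - b + (c - d) = a + c - (b + d).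
Proof. by rewrite opprD addrACA. Qed.

Lemma cocycle2_0 (T : Type) (G : group_on T) (rho : T -> zaut I) c :
  (forall g h, c g h = 0) -> cocycle2 G rho c.
Proof. by move=> c0; split=> *; rewrite !c0 ?raddf0 ?subr0 ?addr0. Qed.

Lemma cocycle2B (T : Type) (G : group_on T) (rho : T -> zaut I) c d e :
  cocycle2 G rho c -> cocycle2 G rho d -> (forall g h, e g h = c g h - d g h) ->
  cocycle2 G rho e.
Proof.
move=> [c1 c2 c3] [d1 d2 d3] eE.
split=> [g|g|g1 g2 g3]; rewrite !eE ?c1 ?c2 ?d1 ?d2 ?subr0 //.
by rewrite (raddfB (rho g3)) subBB addBB subBB c3 d3 subr0.
Qed.

Lemma sb_cochainB (x y : sb_cochain H I) h1 h2 :
  ((x - y).1 h1 h2 = x.1 h1 h2 - y.1 h1 h2) *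
  ((x - y).2 h1 h2 = x.2 h1 h2 - y.2 h1 h2).
Proof. by []. Qed.

Lemma sb_cocycle_zmod_closed : zmod_closed sb_cocycle_pred.
Proof.
split=> [|x y /asboolP [nx1 nx2 cx1 cx2 ex] /asboolP [ny1 ny2 cy1 cy2 ey]].
  apply/asboolP; split=> //=.
  - exact: cocycle2_0.
  - by apply: cocycle2_0 => g h; rewrite /tau_bar zaut_inv0.
  - have e a b : (0 : H -> H -> I) a b = 0 by [].
    move=> h1 h2 h3.
    by rewrite /= !e (raddf0 (nu _)) !(raddf0 (mu _)) !subr0 !addr0.
apply/asboolP; split.
- move=> h; rewrite !sb_cochainB.
  by rewrite !(nx1 h).1 !(nx1 h).2 !(ny1 h).1 !(ny1 h).2 subr0.
- move=> h; rewrite !sb_cochainB.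
  by rewrite !(nx2 h).1 !(nx2 h).2 !(ny2 h).1 !(ny2 h).2 subr0.
- by apply: cocycle2B cx1 cy1 _ => g h; rewrite sb_cochainB.
- by apply: cocycle2B cx2 cy2 _ => g h; rewrite /tau_bar sb_cochainB zaut_invB.
- move=> h1 h2 h3; rewrite !sb_cochainB (raddfB (mu _)) subBB addBB ex ey.
  rewrite (raddfB (mu _)) (raddfB (nu _)) addBB.
  by rewrite [X in _ = X - _]subBB [RHS]subBB.
Qed.

HB.instance Definition _ :=
  GRing.isZmodClosed.Build (sb_cochain H I) sb_cocycle_pred
    sb_cocycle_zmod_closed.

Record Z2Sb := MkZ2Sb {
  z2_val : sb_cochain H I;
  z2_valP : z2_val \in sb_cocycle_pred
}.

HB.instance Definition _ := [isSub for z2_val].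
HB.instance Definition _ := [Choice of Z2Sb by <:].
HB.instance Definition _ := [SubChoice_isSubZmodule of Z2Sb by <:].

(* [x - y] lies in this predicate exactly when x and y are cohomologous. *)
Definition B2Sb : {pred Z2Sb} := fun x => `[< sb_coboundary (val x) >].

Lemma B2Sb_zmod_closed : zmod_closed B2Sb.
Proof.
split=> [|x y /asboolP [u [u0 u1 u2]] /asboolP [v [v0 v1 v2]]].
  apply/asboolP; exists (fun=> 0); split=> // h1 h2.
    by rewrite (raddf0 (mu _)) subr0 addr0.
  by rewrite zaut_inv0 (raddf0 (sigma _)) !(raddf0 (nu _)) subr0 addr0.
apply/asboolP; exists (fun h => u h - v h); split=> [|h1 h2|h1 h2].
- by rewrite u0 v0 subr0.
- by rewrite (raddfB val) sb_cochainB u1 v1 (raddfB (mu _)) subBB addBB.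
- rewrite (raddfB val) sb_cochainB u2 v2 zaut_invB (raddfB (sigma _)).
  by rewrite !(raddfB (nu _)) subBB addBB.
Qed.

HB.instance Definition _ :=
  GRing.isZmodClosed.Build Z2Sb B2Sb B2Sb_zmod_closed.

Definition H2Sb : zmodType := Quotient.quot B2Sb.

Lemma H2Sb_eqP (x y : Z2Sb) :
  \pi_(Quotient.quot B2Sb)%qT x = \pi_(Quotient.quot B2Sb)%qT y <->
  sb_coboundary (val x - val y).
Proof.
rewrite -(raddfB val); split=> [/eqP|xy]; last apply/eqP.
  by rewrite -Quotient.idealrBE => /asboolP.
by rewrite -Quotient.idealrBE; apply/asboolP.
Qed.

End Cohomology.

Arguments B2Sb {H I} t.

(* Main.v *)
(* A pair (beta, tau) encodes an extension of H by I with a section s: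
   s(h1) + s(h2) = s(h1 + h2) + beta(h1, h2) and
   s(h1) o s(h2) = s(h1 o h2) + tau(h1, h2).  In the opposite extension the
   kernel elements move to the other side of s, which twists them by mu^-1, so
   the same section has the cocycles
   beta'(h1, h2) = mu_{-(h2 + h1)} beta(h2, h1) and
   tau'(h1, h2) = mu_{-(h1 o h2)} tau(h1, h2).  This is an additive bijection
   of cochains; each cocycle identity for H^op is an automorphism mu_{-h}
   applied, up to sign, to one for H, and a coboundary of theta becomes the
   coboundary of h |-> mu_{-h} (theta h). *)
From HB Require Import structures.
Require Import Defs.
From mathcomp Require Import all_boot all_algebra.
From mathcomp Require Import boolp functions.

Set Implicit Arguments.
Unset Strict Implicit.
Unset Printing Implicit Defensive.

Import GRing.Theory.
Local Open Scope ring_scope.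

(** * Isomorphisms between quotients of abelian groups *)

Section QuotientIso.
Variables (U V : zmodType) (S : zmodClosed U) (T : zmodClosed V).
Variables (f : {additive U -> V}) (g : V -> U).
Hypotheses (fK : cancel f g) (gK : cancel g f).
Hypothesis fS : forall x, (f x \in T) = (x \in S).

Definition quot_map (p : Quotient.quot S) : Quotient.quot T :=
  (\pi_(Quotient.quot T) (f (repr p)))%qT.

Definition quot_map_inv (q : Quotient.quot T) : Quotient.quot S :=
  (\pi_(Quotient.quot S) (g (repr q)))%qT.

(** The chosen representative differs from [x] by an element of [S], which [f] sends into [T] by
    [fS]. *)
Lemma quot_map_pi x :
  quot_map (\pi_(Quotient.quot S) x)%qT = (\pi_(Quotient.quot T) (f x))%qT.
Proof.
by apply/eqP; rewrite /quot_map -Quotient.idealrBE -raddfB fS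
  Quotient.idealrBE reprK.
Qed.

Lemma quot_map_inv_pi y :
  quot_map_inv (\pi_(Quotient.quot T) y)%qT = (\pi_(Quotient.quot S) (g y))%qT.
Proof.
by apply/eqP; rewrite /quot_map_inv -Quotient.idealrBE -fS raddfB !gK
  Quotient.idealrBE reprK.
Qed.

Lemma quot_map_is_zmod_morphism : zmod_morphism quot_map.
Proof.
move=> p q; rewrite -[p]reprK -[q]reprK -raddfB !quot_map_pi.
by rewrite -(raddfB (\pi_(Quotient.quot T))%qT) raddfB.
Qed.

Lemma quot_map_bij : bijective quot_map.
Proof.
exists quot_map_inv => [p|q].
  by rewrite -[p]reprK quot_map_pi quot_map_inv_pi fK.
by rewrite -[q]reprK quot_map_inv_pi quot_map_pi gK.
Qed.

Lemma quot_iso :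
  exists h : {additive Quotient.quot S -> Quotient.quot T}, bijective h.
Proof.
pose m := GRing.isZmodMorphism.Build _ _ _ quot_map_is_zmod_morphism.
pose h : {additive Quotient.quot S -> Quotient.quot T} := HB.pack quot_map m.
by exists h; apply: quot_map_bij.
Qed.

End QuotientIso.

(* The three correction terms of [sb_compatible] express -s(a) through s(-a);
   the additive cocycle identity at (a, -a, a o c) collapses them. *)
Lemma sb_compatibleE (H : skewBrace) (I : zmodType) (t : good_triplet H I)
    (beta tau : H -> H -> I) :
  sb_normalized beta -> cocycle2 (sb_add H) (mu t) beta ->
  sb_compatible t beta tau <->
  forall a b c,
    mu t (lam a c) (tau a b) - tau a (b + c)%SB + tau a c =
    nu t a (beta b c) + beta a (lam a c) - beta (a <o> b)%SB (lam a c).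
Proof.
move=> n [_ _ cyc].
have E y a c :
    y + mu t (a <o> c)%SB (beta a (- a)%SB) - beta (- a)%SB (a <o> c)%SB =
    y + beta a (lam a c).
  move: (cyc a (- a)%SB (a <o> c)%SB); rewrite gopxV (n _).1 subr0 -/(lam _ _).
  by move/eqP; rewrite subr_eq0 => /eqP <-; rewrite addrA addrAC addrK.
by split=> C a b c; move: (C a b c); rewrite E.
Qed.

(** * Cocycle conditions for the opposite brace *)

Section OppositeCohomology.
Variables (H : skewBrace) (I : zmodType) (t : good_triplet H I).
Implicit Types (h a b c : H) (y : I) (beta tau : H -> H -> I).

Lemma mu_comp a b y : mu t a (mu t b y) = mu t (b + a)%SB y.
Proof. by rewrite mu_antihom. Qed.

Lemma mu_eq0 a y : mu t a y = 0 <-> y = 0.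
Proof. by split=> [m0|->]; rewrite ?raddf0 // -(muKN t a y) m0 raddf0. Qed.

Definition beta_op beta : sb_op H -> sb_op H -> I :=
  fun h1 h2 => mu t (- (h2 + h1 : H))%SB (beta h2 h1).

Definition tau_op tau : sb_op H -> sb_op H -> I :=
  fun h1 h2 => mu t (- (h1 <o> h2 : H))%SB (tau h1 h2).

Lemma sb_normalized_beta_op beta :
  sb_normalized (H := sb_op H) (beta_op beta) <-> sb_normalized beta.
Proof.
by split=> n h; have [n1 n2] := n h; split; apply/mu_eq0;
  first [exact: n1 | exact: n2].
Qed.

Lemma sb_normalized_tau_op tau :
  sb_normalized (H := sb_op H) (tau_op tau) <-> sb_normalized tau.
Proof.
by split=> n h; have [n1 n2] := n h; split; apply/mu_eq0;
  first [exact: n1 | exact: n2].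
Qed.

(** Reversing the arguments permutes the terms of the identity: at (a, b, c) it becomes minus the
    original one at (c, b, a), under $\mu_{-(c+b+a)}$. *)
Lemma cocycle2_add_op beta :
  cocycle2 (sb_add (sb_op H)) (mu_op t) (beta_op beta) <->
  cocycle2 (sb_add H) (mu t) beta.
Proof.
have opE a b c :
    beta_op beta b c - beta_op beta (b + a)%SB c + beta_op beta a (c + b)%SB
      - mu t (- c)%SB (beta_op beta a b) =
    - mu t (- (c + b + a))%SB (beta b a - beta (c + b)%SB a
      + beta c (b + a)%SB - mu t a (beta c b)).
  rewrite /beta_op !(raddfB, raddfD) /= !mu_comp !ginvM !gopA gopxV gop1x.
  by rewrite !opprK [RHS](ACl (4*3*2*1)).
split=> -[c1 c2 c3]; split=> [g|g|g1 g2 g3].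
all: try by apply/mu_eq0; first [exact: c1 | exact: c2].
  apply/(mu_eq0 (- (g1 + g2 + g3))%SB)/eqP; rewrite -oppr_eq0 -opE; apply/eqP.
  exact: c3.
by rewrite [LHS]opE c3 raddf0 oppr0.
Qed.

(** The twist in [tau_op] is the [mu] factor of [nu_op] at the circle product, so it cancels. As the
    circle group and [sigma] are shared, the multiplicative condition is unchanged. *)
Lemma tau_bar_op tau : tau_bar (op_triplet t) (tau_op tau) = tau_bar t tau.
Proof.
apply/funext=> a; apply/funext => b.
by rewrite /tau_bar /tau_op /= zaut_inv_muN muNK.
Qed.

(** The factor [mu t (- a)] of [nu_op] cancels the last summand of
    [lam a (- b) = - (a <o> b) + a]. *)
Lemma nu_op_mu a b y :
  nu_op t a (mu t (- b)%SB y) = mu t (- (a <o> b))%SB (nu t a y).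
Proof. by rewrite /nu_op /= nu_mu mu_comp lamN gopxK. Qed.

(** In the form of [sb_compatibleE], the opposite identity at (a, b, c) is the original one at (a,
    c, b), under $\mu_{-(a\circ(c+b))}$. *)
Lemma sb_compatible_op beta tau :
  sb_normalized beta -> cocycle2 (sb_add H) (mu t) beta ->
  sb_compatible (op_triplet t) (beta_op beta) (tau_op tau) <->
  sb_compatible t beta tau.
Proof.
move=> nb cb.
have nb' := (sb_normalized_beta_op beta).2 nb.
have cb' := (cocycle2_add_op beta).2 cb.
have CE' := sb_compatibleE (t := op_triplet t) (tau_op tau) nb' cb'.
apply: iff_trans CE' _.
apply: iff_trans _ (iff_sym (sb_compatibleE tau nb cb)).
(* Here [l] is [lam a c] computed in [sb_op H]. *)
have E a b c : let l := ((a <o> c) - a)%SB in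
    mu t (- l)%SB (tau_op tau a b) - tau_op tau a (c + b)%SB + tau_op tau a c
    - (nu_op t a (beta_op beta b c) + beta_op beta a l
        - beta_op beta (a <o> b)%SB l) =
    mu t (- (a <o> (c + b)))%SB
      (mu t (lam a b) (tau a c) - tau a (c + b)%SB + tau a b
       - (nu t a (beta c b) + beta a (lam a b)
           - beta (a <o> c)%SB (lam a b))).
  (* a o c - a + a o b is bracketed as a o c + lam a b in H and as
     l + a o b in H^op; the cocycle identity at (l, a, lam a b) compares
     the two. *)
  move=> l; have [_ _ /(_ l a (lam a b))] := cb.
  have -> : (l + a)%SB = (a <o> c)%SB by rewrite /l gopxVK.
  have -> : (a + lam a b)%SB = (a <o> b)%SB by rewrite /lam gopVKx.
  move/eqP; rewrite subr_eq0 => /eqP cyc.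
  have -> y : y + beta a (lam a b) - beta (a <o> c)%SB (lam a b) =
      y + mu t (lam a b) (beta l a) - beta l (a <o> b)%SB.
    by rewrite -cyc !addrA addrK.
  rewrite /beta_op nu_op_mu /tau_op !(raddfB, raddfD) /= !mu_comp.
  have -> : (l + a)%SB = (a <o> c)%SB by rewrite /l gopxVK.
  have -> : (l + (a <o> b))%SB = (a <o> (c + b))%SB by rewrite sb_distr.
  have -> : (lam a b - (a <o> (c + b)))%SB = (- (a <o> c))%SB.
    by rewrite sb_op_distr ginvM gopVKx.
  have -> : (- (a <o> b) - l)%SB = (- (a <o> (c + b)))%SB.
    by rewrite -ginvM sb_distr.
  by congr (_ + _); rewrite [LHS](ACl (3*2*1)).
split=> C a b c.
  apply/eqP; rewrite -subr_eq0; apply/eqP.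
  apply/(mu_eq0 (- (a <o> (b + c)))%SB); rewrite -E; apply/eqP.
  by rewrite subr_eq0; apply/eqP; exact: C.
apply/eqP; rewrite -subr_eq0; apply/eqP; rewrite [LHS]E; apply/mu_eq0/eqP.
by rewrite subr_eq0; apply/eqP; exact: C.
Qed.

(** * Transfer of cocycles and coboundaries *)

Definition op_cochain (x : sb_cochain H I) : sb_cochain (sb_op H) I :=
  (beta_op x.1, tau_op x.2).

Definition unop_cochain (x : sb_cochain (sb_op H) I) : sb_cochain H I :=
  (fun a b => mu t (a + b)%SB (x.1 b a), fun a b => mu t (a <o> b)%SB (x.2 a b)).

Lemma op_cochainK : cancel op_cochain unop_cochain.
Proof.
by case=> beta tau; congr pair; apply/funext => a; apply/funext => b; apply: muNK.
Qed.

Lemma unop_cochainK : cancel unop_cochain op_cochain.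
Proof.
by case=> beta tau; congr pair; apply/funext => a; apply/funext => b; apply: muKN.
Qed.

Lemma op_cochainB (x y : sb_cochain H I) :
  op_cochain (x - y) = op_cochain x - op_cochain y.
Proof.
by congr pair; apply/funext => a; apply/funext => b; apply: raddfB.
Qed.

Lemma sb_cocycle_op x : sb_cocycle (op_triplet t) (op_cochain x) <-> sb_cocycle t x.
Proof.
split=> -[/= n1 n2 c1 c2 C].
  (* [sb_compatible_op] presupposes these two facts about the original [beta], so they are
     transferred first. *)
  move/sb_normalized_beta_op: n1 => n1; move/cocycle2_add_op: c1 => c1.
  split=> //; first exact/sb_normalized_tau_op.
    by move: c2; rewrite tau_bar_op.
  exact/sb_compatible_op.
split; first exact/sb_normalized_beta_op.
- exact/sb_normalized_tau_op.
- exact/cocycle2_add_op.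
- by rewrite tau_bar_op.
- exact/sb_compatible_op.
Qed.

Lemma sb_coboundary_op x :
  sb_coboundary (op_triplet t) (op_cochain x) <-> sb_coboundary t x.
Proof.
(* The additive coboundary of the twisted [u] at (a, b) comes from that of [u] at (b, a); in [E2]
   the arguments keep their order. *)
have E1 (u : H -> I) a b :
    mu t (- b)%SB (u b) - mu t (- (b + a))%SB (u (b + a)%SB)
      + mu t (- b)%SB (mu t (- a)%SB (u a)) =
    mu t (- (b + a))%SB (u a - u (b + a)%SB + mu t a (u b)).
  rewrite !(raddfB, raddfD) /= !mu_comp ginvM gopA gopxV gop1x.
  by rewrite [LHS](ACl (3*2*1)).
have E2 (u : H -> I) a b :
    nu_op t a (mu t (- b)%SB (u b)) - mu t (- (a <o> b))%SB (u (a <o> b)%SB)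
      + nu_op t (a <o> b)%SB (sigma t b
          (zaut_inv (nu_op t a) (mu t (- a)%SB (u a)))) =
    mu t (- (a <o> b))%SB (nu t a (u b) - u (a <o> b)%SB
      + nu t (a <o> b)%SB (sigma t b (zaut_inv (nu t a) (u a)))).
  by rewrite nu_op_mu /= zaut_inv_muN muNK !(raddfB, raddfD).
split=> -[u [u0 u1 u2]].
  (* Untwisting [u] gives the witness: [E1] and [E2] twist it back to [u] by [muKN]. *)
  exists (fun h => mu t h (u h)); split=> [|a b|a b].
  - by apply/mu_eq0.
  - apply: (@zaut_inj _ (mu t (- (a + b)))%SB).
    by apply: etrans (u1 b a) _; rewrite -(E1 (fun h => mu t h (u h))) !muKN.
  - apply: (@zaut_inj _ (mu t (- (a <o> b)))%SB).
    by apply: etrans (u2 a b) _; rewrite -(E2 (fun h => mu t h (u h))) !muKN.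
exists (fun h => mu t (- h)%SB (u h)); split=> [|a b|a b].
- exact/mu_eq0.
- by rewrite /= /beta_op u1 -E1.
- by rewrite /= /tau_op u2 -E2.
Qed.

Lemma op_cochain_subproof (x : Z2Sb t) :
  op_cochain (val x) \in sb_cocycle_pred (op_triplet t).
Proof. by apply/asboolP/sb_cocycle_op/asboolP; exact: (z2_valP x). Qed.

Lemma unop_cochain_subproof (x : Z2Sb (op_triplet t)) :
  unop_cochain (val x) \in sb_cocycle_pred t.
Proof.
apply/asboolP/sb_cocycle_op; rewrite unop_cochainK.
by apply/asboolP; exact: (z2_valP x).
Qed.

Definition op_cocycle (x : Z2Sb t) : Z2Sb (op_triplet t) :=
  MkZ2Sb (op_cochain_subproof x).

Definition unop_cocycle (x : Z2Sb (op_triplet t)) : Z2Sb t :=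
  MkZ2Sb (unop_cochain_subproof x).

Lemma op_cocycleK : cancel op_cocycle unop_cocycle.
Proof. by move=> x; apply: val_inj; apply: op_cochainK. Qed.

Lemma unop_cocycleK : cancel unop_cocycle op_cocycle.
Proof. by move=> x; apply: val_inj; apply: unop_cochainK. Qed.

Lemma op_cocycle_is_zmod_morphism : zmod_morphism op_cocycle.
Proof. by move=> x y; apply: val_inj; apply: op_cochainB. Qed.

HB.instance Definition _ :=
  GRing.isZmodMorphism.Build (Z2Sb t) (Z2Sb (op_triplet t)) op_cocycle
    op_cocycle_is_zmod_morphism.

Lemma op_cocycle_B2Sb x : (op_cocycle x \in B2Sb (op_triplet t)) = (x \in B2Sb t).
Proof.
by apply/asboolP/asboolP => /sb_coboundary_op.
Qed.

End OppositeCohomology.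

Theorem theorem1p2 (H : skewBrace) (I : zmodType) (t : good_triplet H I) :
  exists f : {additive H2Sb t -> H2Sb (op_triplet t)}, bijective f.
Proof.
exact: quot_iso (@op_cocycleK _ _ t) (@unop_cocycleK _ _ t) (@op_cocycle_B2Sb _ _ t).
Qed.
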